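(* Over any finite alphabet $A$, the temporal logics $\mathit{ThTL}$, $\mathit{BThTL}$, $\mathit{InvTL}$, $\mathit{BInvTL}$ and the two-variable logics $FO^2[<,\mathrm{th}]$ and $FO^2[<,\mathrm{bet}]$ all define the same family of languages.
   Context: Let $A$ be a finite alphabet; words have positions $1,\dots,|w|$ and $w(i)$ is the $i$-th letter. A threshold constraint is an expression $\#B\sim c$ with $B\subseteq A$, integer $c\ge 0$ and $\sim\in\{<,\le,>,\ge,=\}$; for $1\le i<j\le|w|$, the triple $(w,i,j)$ satisfies it if $|\{k: i<k<j,\ w(k)\in B\}|\sim c$; satisfaction of boolean combinations of constraints is defined in the obvious way. Temporal formulas are built from atomic formulas $a\in A$ by $\neg,\wedge,\vee$ and modalities $F_g\gamma$, $P_g\gamma$ where $g$ is a guard. They are interpreted in marked words $(w,i)$: $(w,i)\models a$ iff $w(i)=a$; $(w,i)\models F_g\gamma$ iff there is $j>i$ with $(w,i,j)$ satisfying $g$ and $(w,j)\models\gamma$; $(w,i)\models P_g\gamma$ iff there is $j<i$ with $(w,j,i)$ satisfying $g$ and $(w,j)\models\gamma$. A formula $\gamma$ defines the language of words $w$ with $(w,1)\models\gamma$. In $\mathit{BThTL}$ guards are arbitrary boolean combinations of threshold constraints; in $\mathit{ThTL}$ guards are single threshold constraints; in $\mathit{InvTL}$ guards are single constraints of the form $\#B=0$; in $\mathit{BInvTL}$ guards are boolean combinations of constraints of the form $\#B=0$. $FO^2[<,\mathrm{bet}]$ is two-variable first-order logic (only two reusable variables) with $<$, unary letter predicates $a(x)$,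 and binary predicates $a(x,y)$ ($a\in A$) meaning some position strictly between $x$ and $y$ carries $a$. $FO^2[<,\mathrm{th}]$ is the analogous two-variable logic with binary predicates $(a,k)(x,y)$ ($a\in A$, $k\ge0$) meaning $x<y$ and at least $k$ positions strictly between $x$ and $y$ carry $a$. *)

(* Defs.v *)
From mathcomp Require Import all_boot.

Set Implicit Arguments.
Unset Strict Implicit.
Unset Printing Implicit Defensive.

Section Syntax.

Variable A : finType.

Inductive cmp := CLt | CLe | CGt | CGe | CEq.

Definition cmp_holds (o : cmp) (m c : nat) : bool :=
  match o with
  | CLt => m < c
  | CLe => m <= c
  | CGt => m > c
  | CGe => m >= c
  | CEq => m == c
  end.

(* [Threshold B o c] is the constraint # B o c. *)
Inductive constraint := Threshold of {set A} & cmp & nat.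

Inductive guard :=
  | GAtom of constraint
  | GNot of guard
  | GAnd of guard & guard
  | GOr of guard & guard.

Inductive tl :=
  | TLetter of A
  | TNot of tl
  | TAnd of tl & tl
  | TOr of tl & tl
  | TFuture of guard & tl
  | TPast of guard & tl.

Definition is_inv_constraint (c : constraint) : bool :=
  if c is Threshold _ CEq 0 then true else false.

Definition any_guard (g : guard) : bool := true.

Definition single_guard (g : guard) : bool :=
  if g is GAtom _ then true else false.

Definition single_inv_guard (g : guard) : bool :=
  if g is GAtom c then is_inv_constraint c else false.

Fixpoint bool_inv_guard (g : guard) : bool :=
  match g with
  | GAtom c => is_inv_constraint c
  | GNot g1 => bool_inv_guard g1
  | GAnd g1 g2 | GOr g1 g2 => bool_inv_guard g1 && bool_inv_guard g2
  end.

Fixpoint guards_in (P : guard -> bool) (f : tl) : bool :=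
  match f with
  | TLetter _ => true
  | TNot f1 => guards_in P f1
  | TAnd f1 f2 | TOr f1 f2 => guards_in P f1 && guards_in P f2
  | TFuture g f1 | TPast g f1 => P g && guards_in P f1
  end.

(* The two variables are the elements of [bool]; [P] is the type of symbols for
   the binary predicates other than < and equality. *)
Inductive fo2 (P : Type) :=
  | FLetter of A & bool
  | FLess of bool & bool
  | FEq of bool & bool
  | FRel of P & bool & bool
  | FNot of fo2 P
  | FAnd of fo2 P & fo2 P
  | FOr of fo2 P & fo2 P
  | FEx of bool & fo2 P
  | FAll of bool & fo2 P.

Fixpoint free_in (P : Type) (x : bool) (f : fo2 P) : bool :=
  match f with
  | FLetter _ y => x == y
  | FLess y z | FEq y z | FRel _ y z => (x == y) || (x == z)
  | FNot f1 => free_in x f1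
  | FAnd f1 f2 | FOr f1 f2 => free_in x f1 || free_in x f2
  | FEx y f1 | FAll y f1 => (x != y) && free_in x f1
  end.

Definition sentence (P : Type) (f : fo2 P) : Prop :=
  forall x, ~~ free_in x f.

End Syntax.

Arguments FLetter {A P}.
Arguments FLess {A P}.
Arguments FEq {A P}.
Arguments FRel {A P}.

Section Semantics.

Variables (A : finType) (w : seq A).

(* Positions are numbered from 0, so the position written 1 on paper is 0. *)
Notation pos := 'I_(size w).

Definition letter (i : pos) : A := tnth (in_tuple w) i.

Definition count_between (B : {set A}) (i j : pos) : nat :=
  #|[set k : pos | (i < k < j) && (letter k \in B)]|.

Definition csat (c : constraint A) (i j : pos) : bool :=
  let: Threshold B o n := c in cmp_holds o (count_between B i j) n.

Fixpoint gsat (g : guard A) (i j : pos) : bool :=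
  match g with
  | GAtom c => csat c i j
  | GNot g1 => ~~ gsat g1 i j
  | GAnd g1 g2 => gsat g1 i j && gsat g2 i j
  | GOr g1 g2 => gsat g1 i j || gsat g2 i j
  end.

Fixpoint tsat (f : tl A) (i : pos) : bool :=
  match f with
  | TLetter a => letter i == a
  | TNot f1 => ~~ tsat f1 i
  | TAnd f1 f2 => tsat f1 i && tsat f2 i
  | TOr f1 f2 => tsat f1 i || tsat f2 i
  | TFuture g f1 => [exists j : pos, [&& i < j, gsat g i j & tsat f1 j]]
  | TPast g f1 => [exists j : pos, [&& j < i, gsat g j i & tsat f1 j]]
  end.

Fixpoint fsat (P : Type) (psat : P -> pos -> pos -> bool) (f : fo2 A P)
    (v : bool -> pos) : bool :=
  match f with
  | FLetter a x => letter (v x) == a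
  | FLess x y => v x < v y
  | FEq x y => v x == v y
  | FRel p x y => psat p (v x) (v y)
  | FNot f1 => ~~ fsat psat f1 v
  | FAnd f1 f2 => fsat psat f1 v && fsat psat f2 v
  | FOr f1 f2 => fsat psat f1 v || fsat psat f2 v
  | FEx x f1 => [exists i : pos, fsat psat f1 [eta v with x |-> i]]
  | FAll x f1 => [forall i : pos, fsat psat f1 [eta v with x |-> i]]
  end.

Definition bet_sat (a : A) (i j : pos) : bool :=
  [exists k : pos, (i < k < j) && (letter k == a)].

Definition th_sat (p : A * nat) (i j : pos) : bool :=
  (i < j) && (p.2 <= count_between [set p.1] i j).

End Semantics.

Section Languages.

Variable A : finType.

(* Languages are sets of nonempty words: the empty word has no first position
   to evaluate a temporal formula at, and it is excluded as a model of
   first-order sentences as well. *)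
Definition tl_language (f : tl A) (w : seq A) : Prop :=
  exists2 i : 'I_(size w), i = 0 :> nat & tsat f i.

Definition fo2_language (P : Type)
    (psat : forall w : seq A, P -> 'I_(size w) -> 'I_(size w) -> bool)
    (f : fo2 A P) (w : seq A) : Prop :=
  0 < size w /\ forall v : bool -> 'I_(size w), fsat (@psat w) f v.

Definition tl_definable (G : guard A -> bool) (L : seq A -> Prop) : Prop :=
  exists2 f : tl A, guards_in G f & forall w, L w <-> tl_language f w.

Definition fo2_definable (P : Type)
    (psat : forall w : seq A, P -> 'I_(size w) -> 'I_(size w) -> bool)
    (L : seq A -> Prop) : Prop :=
  exists2 f : fo2 A P, sentence f & forall w, L w <-> fo2_language psat f w.

Definition BThTL_definable := tl_definable (@any_guard A).
Definition ThTL_definable := tl_definable (@single_guard A).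
Definition InvTL_definable := tl_definable (@single_inv_guard A).
Definition BInvTL_definable := tl_definable (@bool_inv_guard A).
Definition FO2_bet_definable := fo2_definable (@bet_sat A).
Definition FO2_th_definable := fo2_definable (@th_sat A).

End Languages.

(* Main.v *)
Require Import Defs.
From mathcomp Require Import all_boot zify.

(** Whether a guard with constants below N holds between two positions depends
    only on the numbers of occurrences, truncated at N, of the letters of the
    word s between them. Keeping, for each letter, N occurrences (or all if there
    are fewer) yields a subword u of s of length at most N |A|; with B the set of
    letters occurring fewer than N times in u, the word s lies in
    (A \ B)* u_1 (A \ B)* ... u_m (A \ B)*, and all words of this language
    have the truncated counts of u. Hence F_g f is a finite disjunction of nested
    formulas F_{#B=0} (u_1 /\ F_{#B=0} (u_2 /\ ... F_{#B=0} f)), which brings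
    BThTL down to InvTL.
    A two-variable formula depends only on the order of the two positions, a
    guard between them, and finitely many temporal formulas at each; this is
    preserved by quantification, by guessing the values of these formulas at the
    two positions. *)

Set Implicit Arguments.
Unset Strict Implicit.
Unset Printing Implicit Defensive.

(** * Enumeration of words of bounded length *)

Section BoundedWords.

Variable T : finType.

Definition words_upto (n : nat) : seq (seq T) :=
  [seq tval t | m <- iota 0 n.+1, t <- enum {: m.-tuple T}].

Lemma mem_words_upto n s : size s <= n -> s \in words_upto n.
Proof.
move=> les; apply/allpairsPdep; exists (size s), (in_tuple s).
by rewrite mem_iota /= add0n ltnS les mem_enum.
Qed.

End BoundedWords.

(** * Derived temporal formulas and inclusion of guard classes *)

Section Formulas.

Variables (A : finType) (a0 : A).

(** The syntax has no constants, so truth is an excluded middle on a fixed letter. *)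
Definition tl_true : tl A := TOr (TLetter a0) (TNot (TLetter a0)).

Definition tl_bool (b : bool) : tl A := if b then tl_true else TNot tl_true.

Definition tl_any (T : Type) (F : T -> tl A) (s : seq T) : tl A :=
  foldr (fun x => TOr (F x)) (tl_bool false) s.

Lemma tsat_bool (w : seq A) (i : 'I_(size w)) b : tsat (tl_bool b) i = b.
Proof. by case: b => /=; case: (_ == _). Qed.

Lemma tsat_any T (F : T -> tl A) s (w : seq A) (i : 'I_(size w)) :
  tsat (tl_any F s) i = has (fun x => tsat (F x) i) s.
Proof. by elim: s => [|x s IH]; [exact: tsat_bool | rewrite /= IH]. Qed.

Lemma guards_in_any T (P : guard A -> bool) (F : T -> tl A) s :
  (forall x, guards_in P (F x)) -> guards_in P (tl_any F s).
Proof. by move=> PF; elim: s => //= x s IH; rewrite PF. Qed.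

Lemma guards_in_mono (P Q : guard A -> bool) (f : tl A) :
  subpred P Q -> guards_in P f -> guards_in Q f.
Proof.
move=> PQ; elim: f => //= [f IHf h IHh|f IHf h IHh|g f IH|g f IH] /andP[H1 H2].
- by rewrite IHf ?IHh.
- by rewrite IHf ?IHh.
- by rewrite PQ ?IH.
- by rewrite PQ ?IH.
Qed.

Lemma tl_definable_mono (P Q : guard A -> bool) L :
  subpred P Q -> tl_definable P L -> tl_definable Q L.
Proof. by move=> PQ [f Pf Lf]; exists f => //; apply: guards_in_mono Pf. Qed.

End Formulas.

(** * The factor of a word strictly between two positions *)

Section Between.

Variables (A : finType) (a0 : A) (w : seq A).

Notation pos := 'I_(size w).

(** For positions [i] and [j] of [w] all indices read lie below [size w], so the default [a0] never
    occurs in the result. *)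
Definition between (i j : nat) : seq A :=
  [seq nth a0 w k | k <- index_iota i.+1 j].

Lemma size_between i j : size (between i j) = j - i.+1.
Proof. by rewrite size_map size_iota. Qed.

Lemma between_cat (i j : nat) (k : pos) : i < k < j ->
  between i j = between i k ++ letter k :: between k j.
Proof.
move=> /andP[ik kj]; rewrite /letter (tnth_nth a0) /= /between.
suff -> : index_iota i.+1 j = index_iota i.+1 k ++ (k : nat) :: index_iota k.+1 j.
  by rewrite map_cat.
rewrite /index_iota (_ : j - i.+1 = (k - i.+1) + (j - k.+1).+1); last by lia.
by rewrite iotaD subnKC.
Qed.

Lemma count_betweenE (B : {set A}) (i j : pos) :
  count_between B i j = count (mem B) (between i j).
Proof.
rewrite count_map -sum1_count (big_nat_widen _ _ (size w)) 1?ltnW //.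
rewrite big_geq_mkord /count_between -sum1_card; apply: eq_bigl => k.
rewrite inE /letter (tnth_nth a0) /=.
by case: (i < k); case: (k < j); case: (_ \in B).
Qed.

End Between.

(** * Guards evaluated on words, and truncated letter counts *)

Section WordGuards.

Variable A : finType.

Fixpoint wsat (g : guard A) (s : seq A) : bool :=
  match g with
  | GAtom (Threshold B o n) => cmp_holds o (count (mem B) s) n
  | GNot g1 => ~~ wsat g1 s
  | GAnd g1 g2 => wsat g1 s && wsat g2 s
  | GOr g1 g2 => wsat g1 s || wsat g2 s
  end.

Lemma gsatE a0 (w : seq A) (g : guard A) (i j : 'I_(size w)) :
  gsat g i j = wsat g (between a0 w i j).
Proof.
elim: g => [[B o n]|g IH|g1 IH1 g2 IH2|g1 IH1 g2 IH2] /=; last 3 first.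
- by rewrite IH.
- by rewrite IH1 IH2.
- by rewrite IH1 IH2.
by rewrite (count_betweenE a0).
Qed.

(** Counts ignore order; this lets past modalities read the factor backwards. *)
Lemma wsat_rev g s : wsat g (rev s) = wsat g s.
Proof.
elim: g => [[B o n]|g IH|g1 IH1 g2 IH2|g1 IH1 g2 IH2] /=; last 3 first.
- by rewrite IH.
- by rewrite IH1 IH2.
- by rewrite IH1 IH2.
by rewrite count_rev.
Qed.

(** Truncating counts at [n.+1] still separates the cases below, equal to and above [n]. *)
Fixpoint guard_bound (g : guard A) : nat :=
  match g with
  | GAtom (Threshold B o n) => n.+1
  | GNot g1 => guard_bound g1
  | GAnd g1 g2 | GOr g1 g2 => maxn (guard_bound g1) (guard_bound g2)
  end.

Lemma count_sum (B : {set A}) (s : seq A) :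
  count (mem B) s = \sum_(a in B) count_mem a s.
Proof.
elim: s => [|x s IH] /=; first by rewrite big1.
rewrite IH big_split /=; congr addn.
rewrite -big_mkcondr /= sum1dep_card.
case: (boolP (x \in B)) => xB.
  by rewrite (eq_card (_ : _ =i pred1 x)) ?card1 // => a;
    rewrite !inE andbC eq_sym; case: eqP => // ->.
by rewrite eq_card0 // => a; rewrite !inE; apply: contraNF xB => /andP[aB /eqP->].
Qed.

(** Addition is compatible with saturation at [N], so counts of a set of letters inherit the
    agreement known for single letters. *)
Lemma minn_sum (N : nat) (P : pred A) (f g : A -> nat) :
  (forall a, minn N (f a) = minn N (g a)) ->
  minn N (\sum_(a | P a) f a) = minn N (\sum_(a | P a) g a).
Proof.
move=> fg; elim/big_rec2: _ => // a x y _ IH.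
by have := fg a; move: IH; rewrite /minn; do !case: ltnP => ?; lia.
Qed.

Lemma wsat_truncated (g : guard A) (N : nat) (s t : seq A) :
  guard_bound g <= N ->
  (forall a, minn N (count_mem a s) = minn N (count_mem a t)) ->
  wsat g s = wsat g t.
Proof.
move=> + eqst; elim: g => [[B o n]|g IH|g1 IH1 g2 IH2|g1 IH1 g2 IH2] /=;
  last 3 first.
- by move=> /IH->.
- by rewrite geq_max => /andP[/IH1-> /IH2->].
- by rewrite geq_max => /andP[/IH1-> /IH2->].
have := minn_sum (mem B) eqst; rewrite -!count_sum.
by case: o => /=; lia.
Qed.

End WordGuards.

(** * Subword patterns and truncation of words *)

Section Patterns.

Variable A : finType.

(* [pattern B u] is the language (A \ B)* u_1 (A \ B)* ... u_m (A \ B)*. *)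
Fixpoint pattern (B : {set A}) (u s : seq A) : Prop :=
  if u is c :: u' then
    exists s1 s2, [/\ s = s1 ++ c :: s2, all [predC B] s1 & pattern B u' s2]
  else all [predC B] s.

(** The letters whose exact count matters. All others have already reached [N] in [u], so the gaps
    may contain them freely. *)
Definition rare (N : nat) (u : seq A) : {set A} := [set a | count_mem a u < N].

Lemma pattern_cons (B : {set A}) u a s :
  a \notin B -> pattern B u s -> pattern B u (a :: s).
Proof.
move=> aB; case: u => [|c u] /=; first by rewrite aB.
by case=> s1 [s2 [-> all1 pu]]; exists (a :: s1), s2; rewrite /= aB.
Qed.

Lemma pattern_count_le (B : {set A}) u s (P : pred A) :
  pattern B u s -> count P u <= count P s.
Proof.
elim: u s => //= c u IH s [s1 [s2 [-> _ /IH le2]]].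
by rewrite count_cat /=; lia.
Qed.

Lemma pattern_count_eq (B : {set A}) u s a :
  pattern B u s -> a \in B -> count_mem a u = count_mem a s.
Proof.
have avoid t : a \in B -> all [predC B] t -> count_mem a t = 0.
  move=> aB /allP allt; apply/count_memPn/negP => /allt.
  by rewrite /= aB.
move=> + aB; elim: u s => [|c u IH] s /=; first by move=> /avoid->.
by case=> s1 [s2 [-> /avoid av /IH eq2]]; rewrite count_cat /= av // eq2.
Qed.

(** Rare letters do not occur in the gaps, so their counts in [s] and [u] agree; any other letter
    has at least [N] occurrences in [u], hence in [s]. *)
Lemma pattern_truncated N u s :
  pattern (rare N u) u s ->
  forall a, minn N (count_mem a s) = minn N (count_mem a u).
Proof.
move=> pu a; have := pattern_count_le (pred1 a) pu.
have [|leN] := ltnP (count_mem a u) N; last first.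
  by move=> le_us; rewrite !(minn_idPl _) // (leq_trans leN).
move=> ltN _; have aR : a \in rare N u by rewrite inE.
by rewrite -(pattern_count_eq pu aR); apply/minn_idPr/ltnW.
Qed.

(** The recursion works from the right: the last [N] occurrences of each letter survive. *)
Fixpoint truncate (N : nat) (s : seq A) : seq A :=
  if s is a :: s' then
    let u := truncate N s' in if count_mem a u < N then a :: u else u
  else [::].

Lemma count_truncate N s a : count_mem a (truncate N s) <= N.
Proof.
elim: s => //= x s IH; case: ifP => //= ltN.
by case: eqP => [<-|_]; rewrite ?add0n.
Qed.

Lemma size_truncate N s : size (truncate N s) <= #|A| * N.
Proof.
have -> : size (truncate N s) = \sum_(a in [set: A]) count_mem a (truncate N s).
  rewrite -count_sum -count_predT; apply: eq_count => a.
  by rewrite /= inE.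
rewrite -cardsT -sum_nat_const; apply: leq_sum => a _; exact: count_truncate.
Qed.

Lemma pattern_truncate N s : pattern (rare N (truncate N s)) (truncate N s) s.
Proof.
(* The forbidden set is freed from the truncated word: passing to a suffix can only enlarge the set
   of rare letters, so a fixed [B] stays inside it. *)
suff H (B : {set A}) : B \subset rare N (truncate N s) -> pattern B (truncate N s) s.
  exact: H.
elim: s B => [|a s IH] B //=; case: ifP => ltN sub.
  exists [::], s; split=> //; apply: IH; apply: subset_trans sub _.
  by apply/subsetP => b; rewrite /rare !inE /=; apply: leq_ltn_trans; exact: leq_addl.
apply: pattern_cons (IH _ sub); apply/negP => /(subsetP sub).
by rewrite /rare inE ltN.
Qed.

End Patterns.

(** * Reduction of arbitrary guards to guards of the form #B = 0 *)

Section ToInvTL.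

Variables (A : finType) (a0 : A).

(* [d = true] stands for the future, [d = false] for the past. *)
Definition modal (d : bool) (g : guard A) (f : tl A) : tl A :=
  if d then TFuture g f else TPast g f.

Definition precedes (d : bool) (i j : nat) : bool := if d then i < j else j < i.

(** Past segments are reversed, so that in both directions letters are listed by increasing distance
    from [i]. *)
Definition segment (d : bool) (w : seq A) (i j : nat) : seq A :=
  if d then between a0 w i j else rev (between a0 w j i).

Lemma tsat_modal d g f (w : seq A) (i : 'I_(size w)) :
  tsat (modal d g f) i =
  [exists j : 'I_(size w), [&& precedes d i j, wsat g (segment d w i j) & tsat f j]].
Proof.
case: d => /=; apply: eq_existsb => j; first by rewrite (gsatE a0).
by rewrite (gsatE a0) wsat_rev.
Qed.

Lemma segment_cat d (w : seq A) (i k j : 'I_(size w)) :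
  precedes d i k -> precedes d k j ->
  segment d w i j = segment d w i k ++ letter k :: segment d w k j.
Proof.
case: d => /= ik kj; first by rewrite (between_cat _ (k := k)) ?ik.
by rewrite (between_cat _ (k := k)) ?ik ?kj // rev_cat rev_cons cat_rcons.
Qed.

Lemma size_segment d (w : seq A) (i j : nat) :
  size (segment d w i j) = if d then j - i.+1 else i - j.+1.
Proof. by case: d; rewrite /= ?size_rev size_between. Qed.

Lemma segment_split d (w : seq A) (i j : 'I_(size w)) s1 c s2 :
  precedes d i j -> segment d w i j = s1 ++ c :: s2 ->
  exists k : 'I_(size w),
    [/\ precedes d i k, precedes d k j, segment d w i k = s1,
        letter k = c & segment d w k j = s2].
Proof.
move=> ij eqs.
have szs := congr1 size eqs; rewrite size_segment size_cat /= in szs.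
(* The letter [c] sits [size s1 + 1] steps away from [i] in direction [d]. *)
have kw : (if d then i.+1 + size s1 else i - (size s1).+1) < size w.
  by case: d ij eqs szs (ltn_ord i) (ltn_ord j) => /=; lia.
have ik : precedes d i (Ordinal kw) by case: d ij eqs szs kw => /=; lia.
have kj : precedes d (Ordinal kw) j by case: d ij eqs szs kw ik => /=; lia.
have sz : size (segment d w i (Ordinal kw)) = size s1.
  by rewrite size_segment; case: d ij eqs szs kw ik kj => /=; lia.
exists (Ordinal kw); move/eqP: eqs.
rewrite (segment_cat ik kj) eqseq_cat // eqseq_cons.
by case/andP=> /eqP-> /andP[/eqP-> /eqP->].
Qed.

Definition avoid (B : {set A}) : guard A := GAtom (Threshold B CEq 0).

Lemma wsat_avoid B s : wsat (avoid B) s = all [predC B] s.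
Proof. by rewrite /= -leqn0 leqNgt -has_count -all_predC. Qed.

Fixpoint chain (d : bool) (B : {set A}) (u : seq A) (f : tl A) : tl A :=
  modal d (avoid B)
    (if u is c :: u' then TAnd (TLetter c) (chain d B u' f) else f).

(** Each modality crosses one gap of the pattern: all but the last land on the next letter of [u],
    the last one lands on [j]. *)
Lemma tsat_chain d B u f (w : seq A) (i : 'I_(size w)) :
  tsat (chain d B u f) i <->
  exists j : 'I_(size w),
    [/\ precedes d i j, pattern B u (segment d w i j) & tsat f j].
Proof.
elim: u i => [|c u IH] i; rewrite /chain -/chain tsat_modal.
  split=> [/existsP[j /and3P[ij]]|[j [ij av fj]]].
    by rewrite wsat_avoid => av fj; exists j.
  by apply/existsP; exists j; rewrite ij wsat_avoid av.
split=> [/existsP[k /and3P[ik]]|[j [ij]]].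
  rewrite wsat_avoid => av /= /andP[/eqP lk /IH[j [kj pu fj]]].
  exists j; split=> //; last first.
    by exists (segment d w i k), (segment d w k j); rewrite (segment_cat ik kj) lk.
  by case: d ik kj {IH av pu} => /= ik kj; apply: ltn_trans ik kj || apply: ltn_trans kj ik.
case=> s1 [s2 [eqs av pu]] fj.
have [k [ik kj eq1 lk eq2]] := segment_split ij eqs.
apply/existsP; exists k; rewrite ik wsat_avoid eq1 av /= lk eqxx /=.
by apply/IH; exists j; rewrite eq2.
Qed.

Definition inv_modal (d : bool) (g : guard A) (f : tl A) : tl A :=
  let N := guard_bound g in
  tl_any a0 (fun u => if wsat g u then chain d (rare N u) u f else tl_bool a0 false)
    (words_upto A (#|A| * N)).

(** Any disjunct is sound because its pattern fixes the truncated counts, hence the value of [g].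
    Conversely, the truncation of the actual segment names a disjunct that holds. *)
Lemma tsat_inv_modal d g f (w : seq A) (i : 'I_(size w)) :
  tsat (inv_modal d g f) i = tsat (modal d g f) i.
Proof.
rewrite tsat_any tsat_modal; apply/hasP/existsP => [[u _]|[j /and3P[ij gj fj]]].
  case: ifP => [gu /tsat_chain[j [ij pu fj]]|_]; last by rewrite tsat_bool.
  exists j; rewrite ij fj andbT.
  by rewrite (wsat_truncated (leqnn _) (pattern_truncated pu)) gu.
set s := segment d w i j in gj; set N := guard_bound g.
exists (truncate N s); first by rewrite mem_words_upto // size_truncate.
have pu := pattern_truncate N s.
rewrite -(wsat_truncated (leqnn _) (pattern_truncated pu)) gj.
by apply/tsat_chain; exists j.
Qed.

Fixpoint to_inv (f : tl A) : tl A :=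
  match f with
  | TLetter a => TLetter a
  | TNot f1 => TNot (to_inv f1)
  | TAnd f1 f2 => TAnd (to_inv f1) (to_inv f2)
  | TOr f1 f2 => TOr (to_inv f1) (to_inv f2)
  | TFuture g f1 => inv_modal true g (to_inv f1)
  | TPast g f1 => inv_modal false g (to_inv f1)
  end.

Lemma tsat_to_inv f (w : seq A) (i : 'I_(size w)) : tsat (to_inv f) i = tsat f i.
Proof.
elim: f i => [a|f IH|f IHf h IHh|f IHf h IHh|g f IH|g f IH] i //.
- by rewrite /= IH.
- by rewrite /= IHf IHh.
- by rewrite /= IHf IHh.
- by rewrite [to_inv _]/= tsat_inv_modal /=; apply: eq_existsb => j; rewrite IH.
- by rewrite [to_inv _]/= tsat_inv_modal /=; apply: eq_existsb => j; rewrite IH.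
Qed.

Lemma guards_in_modal P d g f :
  guards_in P (modal d g f) = P g && guards_in P f.
Proof. by case: d. Qed.

Lemma guards_in_inv_modal d g f :
  guards_in (@single_inv_guard A) f ->
  guards_in (@single_inv_guard A) (inv_modal d g f).
Proof.
move=> invf; apply: guards_in_any => u; case: ifP => // _.
(* Only the traversed word varies in the induction; the forbidden set remains that of the whole
   [u]. *)
by elim: {2}u => [|c v IH] /=; rewrite guards_in_modal.
Qed.

Lemma guards_in_to_inv f : guards_in (@single_inv_guard A) (to_inv f).
Proof.
elim: f => //= [f IHf h IHh|f IHf h IHh|g f IH|g f IH].
- by rewrite IHf.
- by rewrite IHf.
- exact: guards_in_inv_modal.
- exact: guards_in_inv_modal.
Qed.

Lemma BThTL_InvTL (L : seq A -> Prop) : BThTL_definable L -> InvTL_definable L.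
Proof.
case=> f _ Lf; exists (to_inv f); first exact: guards_in_to_inv.
move=> w; rewrite Lf; split=> -[i i0 fi]; exists i; rewrite // ?tsat_to_inv //.
by rewrite -tsat_to_inv.
Qed.

End ToInvTL.

(** * From two-variable logic to temporal logic with arbitrary guards *)

Section TwoVariableToTemporal.

Variables (A : finType) (a0 : A).

Definition binary_relation := forall w : seq A, 'I_(size w) -> 'I_(size w) -> bool.

Definition color (cs : seq (tl A)) (w : seq A) (i : 'I_(size w)) : seq bool :=
  [seq tsat c i | c <- cs].

(** Characteristic formula of a truth vector; a vector of the wrong length yields falsity, so
    vectors need no length condition. *)
Fixpoint has_color (cs : seq (tl A)) (e : seq bool) : tl A :=
  match cs, e with
  | [::], [::] => tl_bool a0 true
  | c :: cs', b :: e' => TAnd (if b then c else TNot c) (has_color cs' e')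
  | _, _ => tl_bool a0 false
  end.

Lemma tsat_has_color cs e (w : seq A) (i : 'I_(size w)) :
  tsat (has_color cs e) i = (color cs i == e).
Proof.
elim: cs e => [|c cs IH] [|b e]; rewrite /has_color -/has_color ?tsat_bool //.
by rewrite /= IH eqseq_cons; case: b => /=; case: (tsat c i).
Qed.

(* A binary relation is separable if, once finitely many temporal formulas have
   been evaluated at both positions, it depends only on the order of the two
   positions and on a guard between them. *)
Definition separable (R : binary_relation) : Prop :=
  exists cs (E : seq bool -> bool) (Glt Ggt : seq bool -> seq bool -> guard A),
  forall (w : seq A) (i j : 'I_(size w)),
    [/\ R w i i = E (color cs i),
        i < j -> R w i j = gsat (Glt (color cs i) (color cs j)) i j
      & i < j -> R w j i = gsat (Ggt (color cs j) (color cs i)) i j].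

Definition constant_guard (b : bool) : guard A :=
  let g := GAtom (Threshold set0 CGe 0) in if b then g else GNot g.

Lemma gsat_constant b (w : seq A) (i j : 'I_(size w)) :
  gsat (constant_guard b) i j = b.
Proof. by case: b. Qed.

Lemma separable_not R : separable R -> separable (fun w i j => ~~ R w i j).
Proof.
case=> cs [E [Gl [Gg H]]].
exists cs, (fun e => ~~ E e), (fun e e' => GNot (Gl e e')), (fun e e' => GNot (Gg e e')).
move=> w i j; have [eq lt gt] := H w i j.
by split=> [|ij|ij] /=; rewrite ?eq ?lt ?gt.
Qed.

Lemma separable_and R1 R2 : separable R1 -> separable R2 ->
  separable (fun w i j => R1 w i j && R2 w i j).
Proof.
move=> [cs1 [E1 [Gl1 [Gg1 H1]]]] [cs2 [E2 [Gl2 [Gg2 H2]]]].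
(* [l] and [r] recover the two colors from the color for the concatenated list. *)
pose l (e : seq bool) := take (size cs1) e; pose r (e : seq bool) := drop (size cs1) e.
have lE (w : seq A) (i : 'I_(size w)) : l (color (cs1 ++ cs2) i) = color cs1 i.
  by rewrite /l /color map_cat take_size_cat // size_map.
have rE (w : seq A) (i : 'I_(size w)) : r (color (cs1 ++ cs2) i) = color cs2 i.
  by rewrite /r /color map_cat drop_size_cat // size_map.
exists (cs1 ++ cs2), (fun e => E1 (l e) && E2 (r e)),
  (fun e e' => GAnd (Gl1 (l e) (l e')) (Gl2 (r e) (r e'))),
  (fun e e' => GAnd (Gg1 (l e) (l e')) (Gg2 (r e) (r e'))).
move=> w i j; have [eq1 lt1 gt1] := H1 w i j; have [eq2 lt2 gt2] := H2 w i j.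
by split=> [|ij|ij]; rewrite /= !lE !rE ?eq1 ?eq2 ?lt1 ?lt2 ?gt1 ?gt2.
Qed.

Lemma separable_ext (R1 R2 : binary_relation) :
  (forall w i j, R1 w i j = R2 w i j) -> separable R1 -> separable R2.
Proof.
move=> eqR [cs [E [Gl [Gg H]]]]; exists cs, E, Gl, Gg => w i j.
by have := H w i j; rewrite !eqR.
Qed.

Lemma separable_or R1 R2 : separable R1 -> separable R2 ->
  separable (fun w i j => R1 w i j || R2 w i j).
Proof.
move=> /separable_not s1 /separable_not s2.
apply: separable_ext (separable_not (separable_and s1 s2)) => w i j.
by rewrite negb_and !negbK.
Qed.

Lemma separable_swap R : separable R -> separable (fun w i j => R w j i).
Proof.
case=> cs [E [Gl [Gg H]]].
exists cs, E, (fun e e' => Gg e' e), (fun e e' => Gl e' e).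
by move=> w i j; have [eq lt gt] := H w i j.
Qed.

Lemma separable_tl (f : tl A) : separable (fun w i _ => tsat f i).
Proof.
exists [:: f], (head false), (fun e _ => constant_guard (head false e)),
  (fun e _ => constant_guard (head false e)) => w i j.
by split=> // _; rewrite gsat_constant.
Qed.

Lemma separable_diag R : separable R -> separable (fun w i _ => R w i i).
Proof.
case=> cs [E [Gl [Gg H]]].
exists cs, E, (fun e _ => constant_guard (E e)), (fun e _ => constant_guard (E e)).
move=> w i j; have [eq _ _] := H w i i; have [eq' _ _] := H w j j.
by split=> // _; rewrite gsat_constant.
Qed.

Lemma separable_guard (g : guard A) :
  separable (fun w i j => (i < j) && gsat g i j).
Proof.
exists [::], (fun _ => false), (fun _ _ => g), (fun _ _ => constant_guard false).
move=> w i j; rewrite gsat_constant ltnn; split=> // ij; rewrite ?ij //.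
by rewrite ltnNge ltnW.
Qed.

Lemma separable_eq : separable (fun w i j => i == j).
Proof.
exists [::], (fun _ => true), (fun _ _ => constant_guard false),
  (fun _ _ => constant_guard false).
move=> w i j; rewrite gsat_constant eqxx.
by split=> // ij; apply/negP => /eqP eqij; rewrite eqij ltnn in ij.
Qed.

Lemma color_words cs (w : seq A) (i : 'I_(size w)) :
  color cs i \in words_upto bool (size cs).
Proof. by apply: mem_words_upto; rewrite size_map. Qed.

(** The formula guesses the color [e'] of [j]. The witness [i] is [j] itself, or lies after or
    before it with a guessed color [e]; once both colors are fixed, a single guard decides the
    relation, and one modality expresses it. *)
Lemma separable_ex R : separable R ->
  exists f : tl A, forall w (j : 'I_(size w)), tsat f j = [exists i, R w i j].
Proof.
case=> cs [E [Gl [Gg H]]].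
pose W := words_upto bool (size cs).
exists (tl_any a0 (fun e' =>
  TAnd (has_color cs e')
    (TOr (tl_bool a0 (E e'))
      (tl_any a0 (fun e => TOr (TFuture (Gg e e') (has_color cs e))
                               (TPast (Gl e e') (has_color cs e))) W))) W) => w j.
rewrite tsat_any; apply/hasP/existsP.
  case=> e' _ /= /andP[]; rewrite tsat_has_color => /eqP eqe'.
  rewrite tsat_bool -eqe' => /orP[Ee|].
    by exists j; have [-> _ _] := H w j j.
  rewrite tsat_any => /hasP[e _ /= /orP[]] /existsP[i /and3P[ij gij]];
    rewrite tsat_has_color => /eqP eqe; exists i; rewrite -eqe in gij.
    by have [_ _ /(_ ij)->] := H w j i.
  by have [_ /(_ ij)-> _] := H w i j.
case=> i Rij; exists (color cs j); first exact: color_words.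
rewrite /= tsat_has_color eqxx tsat_bool /=.
have [ij|ji|eqij] := ltngtP i j.
- apply/orP; right; rewrite tsat_any; apply/hasP; exists (color cs i).
    exact: color_words.
  apply/orP; right; apply/existsP; exists i; rewrite ij -/(tsat _ _) tsat_has_color eqxx andbT.
  by have [_ /(_ ij)<- _] := H w i j.
- apply/orP; right; rewrite tsat_any; apply/hasP; exists (color cs i).
    exact: color_words.
  apply/orP; left; apply/existsP; exists i; rewrite ji -/(tsat _ _) tsat_has_color eqxx andbT.
  by have [_ _ /(_ ji)<-] := H w j i.
have {}eqij : i = j by apply: val_inj.
by rewrite eqij in Rij; have [<- _ _] := H w j j; rewrite Rij.
Qed.

Variables (P : Type)
  (psat : forall w : seq A, P -> 'I_(size w) -> 'I_(size w) -> bool)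
  (pguard : P -> guard A).
(** This form covers the predicates of both two-variable logics. *)
Hypothesis psatE : forall (w : seq A) p (i j : 'I_(size w)),
  psat p i j = (i < j) && gsat (pguard p) i j.

(** Atoms may use the variables in either order or repeat one; swapping and restricting to the
    diagonal bring them to the order [false], [true]. *)
Lemma separable_vars (R : binary_relation) (x y : bool) : separable R ->
  exists2 S, separable S & forall (w : seq A) (v : bool -> 'I_(size w)),
    R w (v x) (v y) = S w (v false) (v true).
Proof.
move=> sR; case: x y => [] [].
- by exists (fun w i j => R w j j) => //; apply/separable_swap/separable_diag.
- by exists (fun w i j => R w j i) => //; apply/separable_swap.
- by exists R.
- by exists (fun w i j => R w i i) => //; apply/separable_diag.
Qed.

Lemma separable_fsat (f : fo2 A P) :
  exists2 S, separable S & forall (w : seq A) (v : bool -> 'I_(size w)),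
    fsat (@psat w) f v = S w (v false) (v true).
Proof.
(* Quantifying one variable leaves a property of the other, given by a temporal formula. Leaving [g]
   abstract lets the universal case apply this to a negation. *)
have ex x g S : separable S ->
    (forall (w : seq A) (v : bool -> 'I_(size w)), g w v = S w (v false) (v true)) ->
  exists2 S', separable S' & forall (w : seq A) (v : bool -> 'I_(size w)),
    [exists i, g w [eta v with x |-> i]] = S' w (v false) (v true).
  case: x => sS gE.
    have [h hE] := separable_ex (separable_swap sS).
    exists (fun w i j => tsat h i) => [|w v]; first exact: separable_tl.
    by rewrite hE; apply: eq_existsb => i; rewrite gE.
  have [h hE] := separable_ex sS.
  exists (fun w i j => tsat h j) => [|w v].
    exact: separable_swap (separable_tl h).
  by rewrite hE; apply: eq_existsb => i; rewrite gE.
elim: f => [a x|x y|x y|p x y|f [S sS SE]|f [S sS SE] g [T sT TE]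
           |f [S sS SE] g [T sT TE]|x f [S sS SE]|x f [S sS SE]].
- exact: (separable_vars x x (separable_tl (TLetter a))).
- apply: (@separable_vars (fun w i j => i < j)).
  apply: separable_ext (separable_guard (constant_guard true)) => w i j.
  by rewrite gsat_constant andbT.
- exact: (separable_vars x y separable_eq).
- apply: (@separable_vars (fun w i j => psat p i j)).
  apply: separable_ext (separable_guard (pguard p)) => w i j.
  by rewrite psatE.
- exists (fun w i j => ~~ S w i j) => [|w v]; first exact: separable_not.
  by rewrite /= SE.
- exists (fun w i j => S w i j && T w i j) => [|w v]; first exact: separable_and.
  by rewrite /= SE TE.
- exists (fun w i j => S w i j || T w i j) => [|w v]; first exact: separable_or.
  by rewrite /= SE TE.
- exact: ex SE.
- have [|S' sS' S'E] := ex x (fun w v => ~~ fsat (@psat w) f v) _ (separable_not sS).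
    by move=> w v; rewrite SE.
  exists (fun w i j => ~~ S' w i j) => [|w v]; first exact: separable_not.
  by rewrite -S'E negb_exists; apply: eq_forallb => i; rewrite negbK.
Qed.

Lemma fo2_BThTL (L : seq A -> Prop) : fo2_definable psat L -> BThTL_definable L.
Proof.
case=> f _ Lf; have [T _ TE] := separable_fsat f.
(* The language requires [f] under every valuation, hence the universal closure; conjunction with
   equality then evaluates [S] on the diagonal at the current position. *)
have [S sS SE] := separable_fsat (FAll false (FAll true f)).
have [h hE] := separable_ex (separable_and separable_eq sS).
exists h => [|w]; first by elim: (h) => //= ? -> // ? ->.
have closedE (v : bool -> 'I_(size w)) :
    reflect (forall v, fsat (@psat w) f v) (S w (v false) (v true)).
  rewrite -SE; apply: (iffP forallP) => [fv v'|fv i].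
    have /forallP/(_ (v' true)) := fv (v' false).
    (* The updated valuation agrees with [v'] only pointwise; passing through [T], which sees just
       the two values, replaces extensionality. *)
    by rewrite -!/(fsat _ _ _) !TE.
  by apply/forallP => j; apply: fv.
rewrite Lf; split=> [[w0 fw]|[i i0]].
  exists (Ordinal w0) => //; rewrite hE; apply/existsP; exists (Ordinal w0).
  by rewrite eqxx; apply/(closedE (fun _ => Ordinal w0)).
rewrite hE => /existsP[j /andP[/eqP-> Sii]]; split.
  by case: i {i0 Sii} => m /=; apply: leq_ltn_trans.
exact/(closedE (fun _ => i)).
Qed.

End TwoVariableToTemporal.

(** * From guards #B = 0 to two-variable logic *)

Section InvTLToTwoVariable.

Variables (A : finType) (a0 : A) (P : Type)
  (psat : forall w : seq A, P -> 'I_(size w) -> 'I_(size w) -> bool)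
  (between_pred : A -> P).
Hypothesis psat_between : forall (w : seq A) a (i j : 'I_(size w)),
  psat (between_pred a) i j = bet_sat a i j.

Definition fo2_avoid (B : {set A}) (x y : bool) : fo2 A P :=
  foldr (fun a => FAnd (FNot (FRel (between_pred a) x y))) (FEq x x) (enum B).

Lemma fsat_avoid B x y (w : seq A) (v : bool -> 'I_(size w)) :
  fsat (@psat w) (fo2_avoid B x y) v = (count_between B (v x) (v y) == 0).
Proof.
have -> : fsat (@psat w) (fo2_avoid B x y) v =
    all (fun a => ~~ bet_sat a (v x) (v y)) (enum B).
  rewrite /fo2_avoid; elim: (enum B) => [|a s IH] /=; first by rewrite eqxx.
  by rewrite IH psat_between.
rewrite cards_eq0; apply/allP/eqP => [none|/setP none a].
  apply/setP => k; rewrite !inE; apply/negP => /andP[ikj kB].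
  have := none (letter k); rewrite mem_enum => /(_ kB)/negP[].
  by apply/existsP; exists k; rewrite ikj /=.
rewrite mem_enum => aB; apply/negP => /existsP[k /andP[ikj /eqP lk]].
by have := none k; rewrite !inE ikj lk aB.
Qed.

Definition guard_set (g : guard A) : {set A} :=
  if g is GAtom (Threshold B _ _) then B else set0.

Lemma gsat_inv (g : guard A) (w : seq A) (i j : 'I_(size w)) :
  single_inv_guard g -> gsat g i j = (count_between (guard_set g) i j == 0).
Proof. by case: g => //= -[B [] []]. Qed.

(** The current position is held by [x]; every modality moves to the other variable, whose previous
    value may be overwritten, so two variables suffice. *)
Fixpoint tl_fo2 (f : tl A) (x : bool) : fo2 A P :=
  match f with
  | TLetter a => FLetter a x
  | TNot f1 => FNot (tl_fo2 f1 x)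
  | TAnd f1 f2 => FAnd (tl_fo2 f1 x) (tl_fo2 f2 x)
  | TOr f1 f2 => FOr (tl_fo2 f1 x) (tl_fo2 f2 x)
  | TFuture g f1 =>
      FEx (~~ x) (FAnd (FLess x (~~ x))
        (FAnd (fo2_avoid (guard_set g) x (~~ x)) (tl_fo2 f1 (~~ x))))
  | TPast g f1 =>
      FEx (~~ x) (FAnd (FLess (~~ x) x)
        (FAnd (fo2_avoid (guard_set g) (~~ x) x) (tl_fo2 f1 (~~ x))))
  end.

Lemma fsat_tl_fo2 f x (w : seq A) (v : bool -> 'I_(size w)) :
  guards_in (@single_inv_guard A) f -> fsat (@psat w) (tl_fo2 f x) v = tsat f (v x).
Proof.
have xNx (b : bool) : (b == ~~ b) = false by case: b.
elim: f x v => //= [f IH|f IHf h IHh|f IHf h IHh|g f IH|g f IH] x v.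
- by move=> invf; rewrite IH.
- by case/andP=> invf invh; rewrite IHf ?IHh.
- by case/andP=> invf invh; rewrite IHf ?IHh.
- case/andP=> invg invf; apply: eq_existsb => j.
  by rewrite fsat_avoid IH //= eqxx xNx gsat_inv.
- case/andP=> invg invf; apply: eq_existsb => j.
  by rewrite fsat_avoid IH //= eqxx xNx gsat_inv.
Qed.

Lemma free_in_tl_fo2 f x : free_in (~~ x) (tl_fo2 f x) = false.
Proof.
by elim: f x => [a|f IH|f IHf h IHh|f IHf h IHh|g f IH|g f IH] x /=;
  rewrite ?eqxx ?IH ?IHf ?IHh //; case: x.
Qed.

Lemma InvTL_fo2 (L : seq A -> Prop) : InvTL_definable L -> fo2_definable psat L.
Proof.
case=> f invf Lf.
(* The first position is singled out as the one with no position before it. *)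
exists (FEx false (FAnd (FNot (FEx true (FLess true false))) (tl_fo2 f false))).
  by case=> //=; have /= -> := free_in_tl_fo2 f false.
move=> w; rewrite Lf; split=> [[i i0 fi]|[w0 /(_ (fun _ => Ordinal w0))]].
  split=> [|v]; first by case: i {i0 fi} => m /=; apply: leq_ltn_trans.
  apply/existsP; exists i; apply/andP; split; last by rewrite -!/(fsat _ _ _) fsat_tl_fo2.
  by rewrite /= negb_exists; apply/forallP => j; rewrite /= i0.
move=> /existsP[i /andP[first]]; rewrite -!/(fsat _ _ _) fsat_tl_fo2 //= => fi; exists i => //.
apply/eqP; rewrite -leqn0 leqNgt; apply: contra first => i_gt0.
by apply/existsP; exists (Ordinal w0).
Qed.

End InvTLToTwoVariable.

(** Betweenness is the threshold predicate with bound 1, and equally the order together with the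
    guard #{a} > 0; each reading serves one translation. *)
Lemma bet_satE (A : finType) (w : seq A) a (i j : 'I_(size w)) :
  bet_sat a i j = (i < j) && (0 < count_between [set a] i j).
Proof.
rewrite /count_between card_gt0; apply/existsP/andP.
  move=> [k /andP[/andP[ik kj] lk]]; split; first exact: ltn_trans ik kj.
  by apply/set0Pn; exists k; rewrite !inE ik kj.
by case=> _ /set0Pn[k]; rewrite !inE => ?; exists k.
Qed.

Theorem theorem4p3 (A : finType) (hA : 0 < #|A|) (L : seq A -> Prop) :
  [<-> ThTL_definable L;
       BThTL_definable L;
       InvTL_definable L;
       BInvTL_definable L;
       FO2_th_definable L;
       FO2_bet_definable L].
Proof.
have [a0 _] : exists a0 : A, a0 \in A by apply/card_gt0P.
have bth_inv := @BThTL_InvTL A a0 L.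
have inv_bet : InvTL_definable L -> FO2_bet_definable L.
  exact: (@InvTL_fo2 A A _ id).
have inv_th : InvTL_definable L -> FO2_th_definable L.
  by apply: (@InvTL_fo2 A _ _ (fun a => (a, 1))) => w a i j; rewrite bet_satE.
have th_bth : FO2_th_definable L -> BThTL_definable L.
  exact: (@fo2_BThTL A a0 _ _ (fun p => GAtom (Threshold [set p.1] CGe p.2))).
have bet_bth : FO2_bet_definable L -> BThTL_definable L.
  apply: (@fo2_BThTL A a0 _ _ (fun a => GAtom (Threshold [set a] CGt 0))) => w a i j.
  exact: bet_satE.
(* The cycle is closed through the implication from [BThTL_definable] to [InvTL_definable]; guards
   of the form #B = 0 belong to every temporal guard class considered. *)
split; last split; last split; last split; last split.
- exact: tl_definable_mono.
- exact: bth_inv.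
- by apply: tl_definable_mono => -[].
- by move=> binv; apply/inv_th/bth_inv; apply: tl_definable_mono binv.
- by move=> /th_bth/bth_inv.
- by move=> /bet_bth/bth_inv; apply: tl_definable_mono => -[].
Qed.
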